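(* Let $X$ be a separable complex Fréchet space and let $T\in\mathfrak L(X)$. If the $\mathbb T$-eigenvectors of $T$ are perfectly spanning, then $T$ is hereditarily $\mathcal U$-frequently hypercyclic.
   Context: The $\mathbb T$-eigenvectors of $T$ are perfectly spanning if for every countable set $N\subset\mathbb T$, the eigenvectors of $T$ with eigenvalues in $\mathbb T\setminus N$ span a dense linear subspace of $X$. The upper density of $A\subset\mathbb N$ is $\limsup_N\#(A\cap[1,N])/N$. $\mathcal N_T(x,V):=\{n\in\mathbb N:T^nx\in V\}$. $T$ is hereditarily $\mathcal U$-frequently hypercyclic if for every countable family $(V_i)_{i\in I}$ of non-empty open subsets of $X$ and every family $(A_i)_{i\in I}$ of subsets of $\mathbb N$ with positive upper density, there exists $x\in X$ such that $\mathcal N_T(x,V_i)\cap A_i$ has positive upper density for every $i\in I$. *)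

(* Defs.v *)
From HB Require Import structures.
From mathcomp Require Import all_boot all_order all_algebra.
From mathcomp Require Import all_classical all_reals all_analysis.
From mathcomp Require Import complex.
Set Implicit Arguments. Unset Strict Implicit. Unset Printing Implicit Defensive.
Import Order.TTheory GRing.Theory Num.Theory.
Import numFieldTopology.Exports.
Local Open Scope classical_set_scope.
Local Open Scope ring_scope.

(* A Fréchet space: a locally convex (built into tvsType) Hausdorff tvs which is
   metrizable (countable neighbourhood base at 0) and complete (every Cauchy
   sequence converges; for metrizable tvs this is equivalent to completeness). *)
Definition frechet_space (R : realType) (X : tvsType R[i]) : Prop :=
  [/\ hausdorff_space X,
      (exists B : nat -> set X, (forall n, nbhs (0 : X) (B n)) /\
          forall U, nbhs (0 : X) U -> exists n, B n `<=` U) &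
      (forall u : nat -> X,
          (forall U, nbhs (0 : X) U ->
             exists N, forall m n, (N <= m)%N -> (N <= n)%N -> U (u m - u n)) ->
          exists l : X, u @ \oo --> l)].

Definition separable (T : topologicalType) : Prop :=
  exists D : set T, countable D /\ dense D.

Definition unit_circle (R : rcfType) : set R[i] := [set z | `|z| = 1].
Arguments unit_circle R : clear implicits.

Definition lin_span (K : pzRingType) (X : lmodType K) (S : set X) : set X :=
  [set x | exists (n : nat) (c : 'I_n -> K) (v : 'I_n -> X),
      (forall i, S (v i)) /\ x = \sum_(i < n) c i *: v i].

Definition eigenvectors_with (K : pzRingType) (X : lmodType K) (T : X -> X)
    (L : set K) : set X :=
  [set x | x != 0 /\ exists2 lam, L lam & T x = lam *: x].

Definition perfectly_spanning (R : realType) (X : tvsType R[i]) (T : X -> X) : Prop :=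
  forall N : set R[i], N `<=` unit_circle R -> countable N ->
    dense (lin_span (eigenvectors_with T (unit_circle R `\` N))).

Definition upper_density (R : realType) (A : set nat) : \bar R :=
  limn_esup (fun N : nat =>
    ((\sum_(1 <= k < N.+1) ((k \in A)%:R : R)) / N%:R)%:E).

Definition return_set (X : Type) (T : X -> X) (x : X) (V : set X) : set nat :=
  [set n | V (iter n T x)].

Definition hereditarily_Ufhc (R : realType) (X : tvsType R[i]) (T : X -> X) : Prop :=
  forall (I : Type) (V : I -> set X) (A : I -> set nat),
    countable [set: I] ->
    (forall i, open (V i) /\ V i !=set0) ->
    (forall i, (0 < upper_density R (A i))%E) ->
    exists x : X, forall i,
      (0 < upper_density R (return_set T x (V i) `&` A i))%E.

(* Main.v *)
(* The set of admissible x is an intersection of countably many open sets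
   {x : #{k <= N : k in A, T^k x in V} >= d N for some N >= n}, so by Baire it
   suffices that for each V and A some d > 0 makes all of them dense. A sum v in V
   of unimodular eigenvectors has an almost periodic orbit; rotating each summand
   gives y whose orbit is near v along a subset of A of positive upper density.
   Discarding the countably many eigenvalues that occur in the basic open sets
   containing only countably many eigenvalues, every remaining eigenvector e is
   approximated by eigenvectors e_1, ..., e_M with distinct eigenvalues. Their
   average is near e, while its orbit is near 0 outside a set of times of density
   O(1/M), because the mean square of (1/M) sum_m lambda_m^k is 1/M. Hence, given w,
   some z near w - y has an orbit near 0 at most times, and x = y + z works. *)
Require Import Defs.
From HB Require Import structures.
From mathcomp Require Import all_boot all_order all_algebra.
From mathcomp Require Import all_classical all_reals all_analysis.
From mathcomp Require Import complex.
From mathcomp Require Import ring lra.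
Import numFieldTopology.Exports.

Set Implicit Arguments. Unset Strict Implicit. Unset Printing Implicit Defensive.
Import Order.TTheory GRing.Theory Num.Theory.
Local Open Scope classical_set_scope.
Local Open Scope ring_scope.

(** * Positive upper density *)

Section Density.
Variable R : realType.
Implicit Types (A B : set nat) (N : nat).

Definition count_upto A N : R := \sum_(1 <= k < N.+1) (k \in A)%:R.

(** A form free of limits and division, so that the constant can be split over unions. At [N = 0]
    the inequality is trivial, which is harmless since [n] is arbitrary. *)
Definition posdens A : Prop :=
  exists2 d : R, 0 < d &
    forall n, exists2 N, (n <= N)%N & d * N%:R <= count_upto A N.

Lemma upper_density_gt0P A : (0 < upper_density R A)%E <-> posdens A.
Proof.
split=> [|[d d0 HA]].
  rewrite /upper_density /limn_esup limf_esupE => lim0.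
  have [d d0 dlim] : exists2 d : R, 0 < d &
      (d%:E < ereal_inf [set ereal_sup ((fun N : nat => (count_upto A N / N%:R)%:E) @` V) | V in \oo])%E.
    move: lim0; rewrite -/(count_upto A _); move: (ereal_inf _) => [r| |] //.
      by rewrite lte_fin => r0; exists (r / 2); rewrite ?lte_fin; lra.
    by move=> _; exists 1; rewrite ?ltry.
  exists d => // n.
  (* Starting at [n.+1] forces [N > 0], so that the quotient by [N] can be cleared. *)
  have : (d%:E < ereal_sup ((fun N : nat => (count_upto A N / N%:R)%:E) @` [set N | (n.+1 <= N)%N]))%E.
    apply: (lt_le_trans dlim); apply: ereal_inf_lbound.
    by exists [set N | (n.+1 <= N)%N] => //; exact: nbhs_infty_ge.
  move=> /ereal_sup_gt[_ [N /= nN <-]]; rewrite lte_fin => dN.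
  exists N; first exact: ltnW.
  by rewrite -ler_pdivlMr ?ltr0n ?(leq_trans _ nN)// ltW.
apply: (@lt_le_trans _ _ d%:E); first by rewrite lte_fin.
rewrite /upper_density /limn_esup limf_esupE.
apply: le_ereal_inf_tmp => _ [V [n _ nV] <-].
have [N nN dN] := HA (maxn n 1).
have [nN' N0] : (n <= N)%N /\ (0 < N)%N by move: nN; rewrite geq_max => /andP[].
apply: le_trans (ereal_sup_ubound _); last first.
  by exists N => //; apply: nV.
by rewrite lee_fin ler_pdivlMr ?ltr0n.
Qed.

Lemma count_uptoU A B C N : A `<=` B `|` C ->
  count_upto A N <= count_upto B N + count_upto C N.
Proof.
move=> AB; rewrite /count_upto -big_split/=; apply: ler_sum => k _.
rewrite -natrD ler_nat.
case: (boolP (k \in A)) => // /set_mem /AB [] /mem_set ->; first by case: (_ \in _).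
by case: (_ \in _).
Qed.

(** If both [B] and [C] fail, each count is eventually below [d / 2 * N]; a common large [N] then
    contradicts subadditivity of the count. *)
Lemma posdensU A B C : A `<=` B `|` C ->
  posdens A -> posdens B \/ posdens C.
Proof.
move=> AB [d d0 HA]; apply: contrapT => /not_orP[nB nC].
have bad D : ~ posdens D -> exists n, forall N, (n <= N)%N -> count_upto D N < d / 2 * N%:R.
  move=> nD; apply: contrapT => nex; apply: nD; exists (d / 2); first lra.
  move=> n; apply: contrapT => nex2; apply: nex; exists n => N nN.
  by rewrite ltNge; apply/negP => dN; apply: nex2; exists N.
have [n1 H1] := bad _ nB; have [n2 H2] := bad _ nC.
have [N nN dN] := HA (maxn n1 n2).
move: nN; rewrite geq_max => /andP[/H1 {}H1 /H2 {}H2].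
have := count_uptoU N AB; lra.
Qed.

Lemma posdens_nonempty A : posdens A -> A !=set0.
Proof.
move=> [d d0 HA]; have [N N1 dN] := HA 1%N.
apply/set0P/negP => /eqP A0; move: dN.
rewrite /count_upto big1 => [|k _]; last by rewrite A0 in_set0.
by rewrite leNgt mulr_gt0 ?ltr0n.
Qed.

(* Induction on [n], cutting off the strip [a <= f < a + e]. *)
Lemma posdens_small_oscillation A (f : nat -> R) a e n :
  posdens A -> (forall k, A k -> a <= f k <= a + n%:R * e) -> 0 < e ->
  exists2 B, B `<=` A & posdens B /\ forall k l, B k -> B l -> `|f k - f l| <= e.
Proof.
move=> + + e0; elim: n A a => [|n IH] A a pA fA.
  exists A => //; split=> // k l /fA + /fA.
  by rewrite mul0r addr0 => /le_anti <- /le_anti <-; rewrite subrr normr0 ltW.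
have /posdensU : A `<=` (A `&` [set k | f k < a + e]) `|` (A `&` [set k | a + e <= f k]).
  by move=> k Ak; case: (ltP (f k) (a + e)) => ?; [left|right].
move=> /(_ pA)[pB|pB].
  exists (A `&` [set k | f k < a + e]); first exact: subIsetl.
  split=> // k l [/fA /andP[ak _] /= ka] [/fA /andP[al _] /= la].
  by rewrite ler_distlC; apply/andP; split; lra.
have [k [Ak /= fk]|B BA HB] := IH _ (a + e) pB.
  by have /andP[_] := fA _ Ak; rewrite fk/= -natr1; lra.
by exists B => // k /BA [].
Qed.

End Density.

(** * Neighbourhoods of zero *)

Section Tvs.
Variables (K : numFieldType) (E : tvsType K).
Implicit Types (U W : set E) (x v : E).

Lemma nbhs_translate x U : nbhs x U <-> nbhs (0 : E) [set v | U (x + v)].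
Proof.
split=> [xU|].
  have := @add_continuous E (x, 0) U; rewrite /= addr0 => /(_ xU)[[A B] /= [Ax B0] AB].
  apply: filterS B0 => v Bv; apply: (AB (x, v)); split => //=.
  exact: nbhs_singleton.
move=> U0; have := @add_continuous E (x, - x) [set v | U (x + v)].
rewrite /= subrr => /(_ U0)[[A B] /= [Ax Bx] AB].
apply: filterS Ax => v Av.
have /= := AB (v, - x); rewrite addrC subrK; apply; split => //=.
exact: nbhs_singleton.
Qed.

Lemma nbhs0_scalar v U : nbhs (0 : E) U ->
  exists2 e : K, 0 < e & forall c, `|c| < e -> U (c *: v).
Proof.
move=> U0; have := @scale_continuous K E (0, v) U; rewrite /= scale0r.
move=> /(_ U0)[[A B] /= [[e e0 eA] Bv] AB]; exists e => // c ce.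
apply: (AB (c, v)); split; last exact: nbhs_singleton.
by apply: eA; rewrite /ball /= sub0r normrN.
Qed.

Lemma nbhs0_scale (c : K) U : nbhs (0 : E) U -> nbhs (0 : E) [set v | U (c *: v)].
Proof.
move=> U0; have := @scale_continuous K E (c, 0) U; rewrite /= scaler0.
move=> /(_ U0)[[A B] /= [Ac B0] AB]; apply: filterS B0 => v Bv.
by apply: (AB (c, v)); split => //; exact: nbhs_singleton.
Qed.

(** These are the balanced sets of topological vector space theory. *)
Definition circled W := forall (c : K) v, `|c| <= 1 -> W v -> W (c *: v).

Lemma nbhs0_circled U : nbhs (0 : E) U ->
  exists2 W, nbhs (0 : E) W & [/\ circled W, W `<=` U &
    forall u v, W u -> W v -> U (u + v)].
Proof.
move=> U0; have := @add_continuous E (0, 0) U; rewrite /= addr0.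
move=> /(_ U0)[[A B] /= [A0 B0] AB].
have := @scale_continuous K E (0, 0) (A `&` B); rewrite /= scale0r.
have AB0 : nbhs (0 : E) (A `&` B) by apply: filterI.
move=> /(_ AB0)[[C D] /= [[e e0 eC] D0] CD].
(* The union of the dilates [c *: D] with [|c| < e] is balanced by construction. It is a
   neighbourhood of zero because it contains the dilate of [D] by [e / 2]. *)
pose W := [set x | exists (c : K) (v : E), [/\ `|c| < e, D v & x = c *: v]].
have WAB : W `<=` A `&` B.
  move=> _ [c [v [ce Dv ->]]]; apply: (CD (c, v)); split => //.
  by apply: eC; rewrite /ball /= sub0r normrN.
have W0 : nbhs (0 : E) W.
  apply: filterS (nbhs0_scale (2 / e) D0) => v Dv.
  exists (e / 2), ((2 / e) *: v); split => //.
    rewrite normrM (gtr0_norm e0) normfV gtr0_norm// ltr_pdivrMr//.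
    by rewrite ltr_pMr// ltr1n.
  by rewrite scalerA mulrA mulfVK ?mulfV ?scale1r// gt_eqF.
exists W => //.
have Wadd u v : W u -> W v -> U (u + v).
  by move=> /WAB[Au _] /WAB[_ Bv]; apply: (AB (u, v)).
split => //.
- move=> c _ c1 [c' [v [c'e Dv ->]]]; exists (c * c'), v; split=> //; last by rewrite scalerA.
  by rewrite normrM (le_lt_trans _ c'e)// ler_piMl.
- by move=> x Wx; rewrite -[x]addr0; apply: Wadd => //; exact: nbhs_singleton.
Qed.

Lemma nbhs0_sum n U : nbhs (0 : E) U ->
  exists2 W, nbhs (0 : E) W & circled W /\
    forall v : 'I_n -> E, (forall i, W (v i)) -> U (\sum_i v i).
Proof.
elim: n U => [|n IH] U U0; have [W W0 [Wc WU Wadd]] := nbhs0_circled U0.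
  exists W => //; split => // v _; rewrite big_ord0; exact: nbhs_singleton.
have [W' W'0 [W'c W'sum]] := IH _ W0.
exists (W `&` W'); first exact: filterI.
split=> [c v c1 [/Wc + /W'c +]|v Wv]; first by move=> /(_ _ c1) ? /(_ _ c1).
rewrite big_ord_recl; apply: Wadd; first by case: (Wv ord0).
by apply: W'sum => i; case: (Wv (lift ord0 i)).
Qed.

End Tvs.

(** * Vectors approximable by vectors whose orbit is mostly small *)

Lemma infinite_set_injection (T : Type) (A : set T) : infinite_set A ->
  exists2 f : nat -> T, injective f & forall n, A (f n).
Proof.
move=> /infiniteP/card_leP[f].
exists (fun n => val (f (SigSub (mem_set (I : [set: nat] n))))) => [m n|n].
  by move=> /val_inj/(@inj _ _ _ f); rewrite !inE => /(_ I I)/(congr1 val).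
exact: set_mem (valP (f _)).
Qed.

(** Multiplying by [1 - z] telescopes the sum to [z - z ^+ N.+1], of modulus at most 2. *)
Lemma norm_sum_expr_le (K : numFieldType) (z : K) N : `|z| = 1 -> z != 1 ->
  `|\sum_(1 <= k < N.+1) z ^+ k| <= 2 / `|1 - z|.
Proof.
move=> z1 zn1; have dz : 0 < `|1 - z| by rewrite normr_gt0 subr_eq0 eq_sym.
rewrite ler_pdivlMr// -normrM.
have -> : (\sum_(1 <= k < N.+1) z ^+ k) * (1 - z) = z - z ^+ N.+1.
  elim: N => [|N IH]; first by rewrite big_geq// mul0r expr1 subrr.
  by rewrite big_nat_recr//= mulrDl IH !exprS; ring.
by rewrite (le_trans (ler_normB _ _))// normrX z1 expr1n.
Qed.

(* The constant is the sum of the off-diagonal bounds [2 / |1 - lam m * (lam m')^*|];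
   on the diagonal this expression is [2 / 0 = 0]. *)
Lemma mean_square_power_sum (K : numClosedFieldType) M (lam : 'I_M -> K) :
  injective lam -> (forall m, `|lam m| = 1) ->
  exists2 C, 0 <= C & forall N,
    \sum_(1 <= k < N.+1) `|\sum_m lam m ^+ k| ^+ 2 <= M%:R * N%:R + C.
Proof.
move=> laminj lam1.
pose z m m' := lam m * (lam m')^*.
exists (\sum_m \sum_m' 2 / `|1 - z m m'|).
  by apply: sumr_ge0 => m _; apply: sumr_ge0 => m' _; rewrite divr_ge0.
move=> N.
rewrite -[leLHS]ger0_norm; last by apply: sumr_ge0 => k _; rewrite exprn_ge0.
have -> : \sum_(1 <= k < N.+1) `|\sum_m lam m ^+ k| ^+ 2 =
    \sum_m \sum_m' \sum_(1 <= k < N.+1) z m m' ^+ k.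
  under eq_bigr => k _.
    rewrite normCK rmorph_sum mulr_suml.
    under eq_bigr => m _ do rewrite mulr_sumr.
    over.
  rewrite exchange_big; apply: eq_bigr => m _.
  rewrite exchange_big; apply: eq_bigr => m' _.
  by apply: eq_bigr => k _; rewrite rmorphXn/= exprMn.
apply: (@le_trans _ _ (\sum_(m < M) \sum_(m' < M)
    ((m' == m)%:R * N%:R + 2 / `|1 - z m m'|))); last first.
  under eq_bigr => m _.
    rewrite big_split/= -mulr_suml (bigD1 m)//= eqxx big1 ?addr0 ?mul1r; last first.
      by move=> m' /negPf ->.
    over.
  by rewrite big_split/= sumr_const card_ord mulr_natl.
apply: (le_trans (ler_norm_sum _ _ _)); apply: ler_sum => m _.
apply: (le_trans (ler_norm_sum _ _ _)); apply: ler_sum => m' _.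
have z1 : `|z m m'| = 1 by rewrite /z normrM norm_conjC !lam1 mulr1.
have [->|mm'] := eqVneq m' m; last first.
  rewrite mul0r add0r; apply: norm_sum_expr_le => //.
  (* If [z m m' = 1], multiplying by [lam m'] and using [|lam m'| = 1] gives [lam m' = lam m]. *)
  apply: contra mm' => /eqP zE; apply/eqP/laminj.
  rewrite -[LHS]mul1r -zE /z -mulrA [_^* * _]mulrC -normCK lam1.
  by rewrite expr1n mulr1.
rewrite mul1r ler_wpDr ?divr_ge0//.
apply: (le_trans (ler_norm_sum _ _ _)).
rewrite (eq_bigr (fun=> 1)) => [|k _].
  by rewrite sumr_const_nat subSS subn0.
by rewrite normrX /z normrM norm_conjC !lam1 mulr1 expr1n.
Qed.

Section Spreading.
Variables (R : realType) (X : tvsType R[i]) (T : {linear X -> X}).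
Implicit Types (U : set X) (x z : X).

Lemma iter_linear_sum n (c lam : 'I_n -> R[i]) (v : 'I_n -> X) k :
  (forall i, T (v i) = lam i *: v i) ->
  iter k T (\sum_i c i *: v i) = \sum_i (c i * lam i ^+ k) *: v i.
Proof.
move=> Tv; elim: k => [|k IH].
  by apply: eq_bigr => i _; rewrite expr0 mulr1.
rewrite iterS IH linear_sum; apply: eq_bigr => i _.
by rewrite linearZ/= Tv scalerA exprS -mulrA [lam i * _]mulrC.
Qed.

Lemma iter_linearD k x z : iter k T (x + z) = iter k T x + iter k T z.
Proof. by elim: k => //= k ->; rewrite linearD. Qed.

Lemma iter_linearZ k (c : R[i]) x : iter k T (c *: x) = c *: iter k T x.
Proof. by elim: k => //= k ->; rewrite linearZ. Qed.

(** One [U] measures both the closeness of [z'] to [z] and the smallness of the orbit. The bound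
    holds for all large [N], so it can be used at whichever [N] witnesses the upper density of
    another set. *)
Definition spreadable z := forall U (eta : R), nbhs (0 : X) U -> 0 < eta ->
  exists2 z', U (z' - z) & exists N0, forall N, (N0 <= N)%N ->
    count_upto R [set k | ~ U (iter k T z')] N <= eta * N%:R.

Lemma spreadable0 : spreadable 0.
Proof.
move=> U eta U0 eta0; exists 0; first by rewrite subr0; exact: nbhs_singleton.
exists 0%N => N _; rewrite /count_upto big1 => [|k _]; first by rewrite mulr_ge0 ?(ltW eta0).
rewrite memNset//= => nU; apply: nU.
have -> : iter k T 0 = 0 by elim: k => //= k ->; rewrite linear0.
exact: nbhs_singleton.
Qed.

Lemma spreadableZ (c : R[i]) z : spreadable z -> spreadable (c *: z).
Proof.
move=> sz U eta U0 eta0.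
have [z' Uz' [N0 HN]] := sz _ eta (nbhs0_scale c U0) eta0.
exists (c *: z'); first by rewrite -scalerBr.
exists N0 => N /HN; congr (_ <= _); congr (count_upto R _ N).
by apply/funext => k /=; rewrite iter_linearZ.
Qed.

Lemma spreadableD z1 z2 : spreadable z1 -> spreadable z2 -> spreadable (z1 + z2).
Proof.
move=> s1 s2 U eta U0 eta0.
have [W W0 [_ _ Wadd]] := nbhs0_circled U0.
have eta2 : 0 < eta / 2 by lra.
have [y1 Wy1 [N1 HN1]] := s1 W _ W0 eta2.
have [y2 Wy2 [N2 HN2]] := s2 W _ W0 eta2.
exists (y1 + y2); first by rewrite opprD addrACA; exact: Wadd.
exists (maxn N1 N2) => N; rewrite geq_max => /andP[/HN1 {}HN1 /HN2 {}HN2].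
apply: le_trans (_ : eta / 2 * N%:R + eta / 2 * N%:R <= _); last by lra.
apply: le_trans (lerD HN1 HN2); apply: count_uptoU => k /= nU.
apply: contrapT => /not_orP[/contrapT W1 /contrapT W2]; apply: nU.
by rewrite iter_linearD; exact: Wadd.
Qed.

Definition eigenvalues_in U : set R[i] :=
  [set lam | unit_circle R lam /\ exists v, [/\ U v, v != 0 & T v = lam *: v]].

(* Averages of many nearby eigenvectors with distinct eigenvalues: by
   orthogonality of characters the orbit is small at most times. *)
Lemma spreadable_eigenvector e :
  (forall U, nbhs e U -> infinite_set (eigenvalues_in U)) -> spreadable e.
Proof.
move=> einf U eta U0 eta0.
have [W W0 [Wc WU Wadd]] := nbhs0_circled U0.
have [ep ep0 We] := nbhs0_scalar e W0.
have [r r0 epE] : exists2 r : R, 0 < r & ep = r%:C%C.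
  have epE := RRe_real (gtr0_real ep0).
  by exists (complex.Re ep); rewrite -1?ltcR epE.
have re0 : 0 < r ^+ 2 * eta by rewrite mulr_gt0// exprn_gt0.
(* By Chebyshev's inequality, a mean square of [1 / M] lets the average have modulus at least [r]
   only on times of density at most [1 / (r ^+ 2 * M)]; [M] makes this less than [eta]. *)
have [M' HM'] : exists M' : nat, (r ^+ 2 * eta)^-1 < M'%:R.
  exists (Num.bound (r ^+ 2 * eta)^-1).
  by rewrite archi_boundP// invr_ge0 ltW.
pose M := M'.+1; have M0 : (0 : R) < M%:R by rewrite ltr0n.
have HM : (M%:R : R) < (r * M%:R) ^+ 2 * eta.
  have : (r ^+ 2 * eta)^-1 < M%:R by apply: lt_trans HM' _; rewrite ltr_nat.
  rewrite -[X in X < _]mul1r ltr_pdivrMr// => ?.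
  have -> : (r * M%:R) ^+ 2 * eta = M%:R * (M%:R * (r ^+ 2 * eta)) by ring.
  by rewrite ltr_pMr.
have [W' W'0 [W'c W'sum]] := nbhs0_sum M W0.
have U'e : nbhs e [set v | W' (v - e)].
  apply/nbhs_translate; apply: filterS W'0 => v; by rewrite /= addrC addKr.
have [f finj fU'] := infinite_set_injection (einf _ U'e).
pose lam (m : 'I_M) := f m.
have laminj : injective lam by move=> m m' /finj/val_inj.
have lamP m : exists v, [/\ W' (v - e), v != 0 & T v = lam m *: v].
  by have [_] := fU' m.
have lam1 m : `|lam m| = 1 by have [] := fU' m.
have [v vP] := choice lamP.
have [C C0 HC] := mean_square_power_sum laminj lam1.
pose w : R[i] := M%:R^-1.
have w0 : 0 <= w by rewrite invr_ge0.
have w1 : w <= 1 by rewrite invf_le1 ?ltr0n// ler1n.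
have wM : \sum_(m < M) w = 1 by rewrite sumr_const card_ord -(mulr_natr w) mulVf// pnatr_eq0.
(* Separates the common direction [e] from the errors [v m - e]. It is used with [a m = w] for
   closeness to [e], and with [a m = w * lam m ^+ k] for the orbit at time [k]. *)
have decomp (a : 'I_M -> R[i]) :
    \sum_m a m *: v m = (\sum_m a m) *: e + \sum_m a m *: (v m - e).
  rewrite scaler_suml -big_split; apply: eq_bigr => m _.
  by rewrite /= -scalerDr addrC subrK.
have small (a : 'I_M -> R[i]) : (forall m, `|a m| <= 1) ->
    W (\sum_m a m *: (v m - e)).
  by move=> a1; apply: W'sum => m; apply: W'c => //; case: (vP m).
exists (\sum_m w *: v m).
  rewrite decomp wM scale1r addrC addKr.
  by apply/WU/small => m; rewrite ger0_norm.
have bad k : ~ U (iter k T (\sum_m w *: v m)) ->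
    (ep * M%:R) ^+ 2 <= `|\sum_m lam m ^+ k| ^+ 2.
  move=> nU; rewrite lerXn2r ?nnegrE ?mulr_ge0 ?(ltW ep0)//.
  (* The order of [R[i]] is partial, so negating the inequality requires both sides to be real. *)
  rewrite real_leNgt ?normr_real ?realM ?realn ?gtr0_real//; apply/negP => lt.
  apply: nU; rewrite (@iter_linear_sum _ _ lam) => [|m]; last by case: (vP m).
  rewrite decomp -mulr_sumr.
  apply: Wadd; last first.
    apply: small => m; rewrite normrM normrX lam1 expr1n mulr1 ger0_norm//.
  apply: We; rewrite normrM ger0_norm// /w mulrC ltr_pdivrMr ?ltr0n//.
have [c CE] : exists c : R, C = c%:C%C.
  by exists (complex.Re C); rewrite (RRe_real (ger0_real C0)).
(* The slack in the choice of [M]: the off-diagonal constant [c] is absorbed by [D * N] once [N]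
   reaches [c / D]. *)
pose D := (r * M%:R) ^+ 2 * eta - M%:R.
have D0 : 0 < D by rewrite subr_gt0.
exists (Num.bound (c / D)) => N HN.
have cN : c <= D * N%:R.
  rewrite mulrC -ler_pdivrMr//; apply: ltW.
  apply: lt_le_trans (_ : (Num.bound (c / D))%:R <= _); last by rewrite ler_nat.
  apply: archi_boundP; rewrite divr_ge0 ?(ltW D0)//.
  by move: C0; rewrite CE lecR.
have rM : 0 < (r * M%:R) ^+ 2 by rewrite exprn_gt0// mulr_gt0.
rewrite -(ler_pM2l rM).
apply: (@le_trans _ _ (M%:R * N%:R + c)); last by move: cN; rewrite /D; lra.
rewrite -lecR; move: (HC N); rewrite CE => HCN.
apply: le_trans (_ : _ <= M%:R * N%:R + c%:C%C) _; last first.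
  by rewrite rmorphD rmorphM !rmorph_nat.
apply: le_trans HCN.
rewrite rmorphM rmorphXn rmorphM rmorph_nat /= -epE rmorph_sum mulr_sumr.
apply: ler_sum => k _; rewrite rmorph_nat.
case: (boolP (k \in _)) => [/set_mem/= /bad|_]; first by rewrite mulr1.
by rewrite mulr0 exprn_ge0.
Qed.

Lemma spreadable_lin_span (S : set X) : (forall e, S e -> spreadable e) ->
  forall z, lin_span S z -> spreadable z.
Proof.
move=> Ss _ [n [c [v [Sv ->]]]].
elim/big_ind: _ => [|x y|i _]; first exact: spreadable0.
  exact: spreadableD.
by apply: spreadableZ; apply: Ss.
Qed.

End Spreading.

(** * Baire category *)

Lemma dense_nbhs (S : topologicalType) (D : set S) (x : S) (U : set S) :
  dense D -> nbhs x U -> exists2 s, D s & U s.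
Proof.
move=> dD xU; have [|s [Us Ds]] := dD (interior U) _ (open_interior U).
  by exists x.
by exists s => //; exact: interior_subset Us.
Qed.

Section Frechet.
Variables (R : realType) (X : tvsType R[i]).
Implicit Types (U V W : set X) (x y z : X).

(** The base consists of the translates of the sets [B n] by the points of a countable dense set. *)
Lemma countable_base : frechet_space X -> separable X ->
  exists2 Bs : set (set X), countable Bs &
    forall x U, nbhs x U -> exists V, [/\ Bs V, nbhs x V & V `<=` U].
Proof.
move=> [_ [B [B0 Bbase]] _] [D [Dc dD]].
exists ((fun p : X * nat => [set z | B p.2 (z - p.1)]) @` (D `*` setT)).
  apply: (sub_countable (card_image_le _ _)).
  by apply: countableX => //; exact: countableP.
move=> x U /nbhs_translate U0.
have [W W0 [Wc WU Wadd]] := nbhs0_circled U0.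
have [n BW] := Bbase _ W0.
(* Asking for the interior makes the translate by [d] a neighbourhood of [x], rather than a set
   merely containing [x]. *)
have [|d Dd Bd] := @dense_nbhs _ D x [set d | (interior (B n)) (x - d)] dD.
  apply/nbhs_translate.
  have := nbhs0_scale (-1) (nbhs_interior (B0 n)); apply: filterS => v /=.
  by rewrite scaleN1r opprD addNKr.
exists [set z | B n (z - d)]; split; first by exists (d, n).
- apply/nbhs_translate; move: Bd => /nbhs_translate; apply: filterS => v /=.
  by rewrite addrAC.
- move=> z /= /BW Wz.
  have Wd : W (d - x).
    rewrite -opprB -scaleN1r; apply: Wc; first by rewrite normrN1.
    by apply: BW; exact: nbhs_singleton Bd.
  by have /= := Wadd _ _ Wz Wd; rewrite subrKA subrKC.
Qed.

(** The usual nested construction, with neighbourhoods of zero in place of balls; the centres are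
    Cauchy because the [n]-th choice lies in [B n]. *)
Lemma frechet_baire (G : nat -> set X) : frechet_space X ->
  (forall n, open (G n)) -> (forall n, dense (G n)) -> exists x, forall n, G n x.
Proof.
move=> [_ [B [B0 Bbase]] Xcomplete] Gopen Gdense.
(* A stage is a centre with a neighbourhood of zero. The sum of two elements [u + v] leaves room for
   the limit: one step to a later centre, one from there to the limit. *)
pose next n (p q : X * set X) := nbhs 0 q.2 /\
  [/\ circled q.2, q.2 `<=` B n & forall u v, q.2 u -> q.2 v ->
    G n (q.1 + (u + v)) /\ p.2 (q.1 + (u + v) - p.1)].
(* The hypothesis stands under the existential so that [choice] yields a total function. *)
have step (np : nat * (X * set X)) : exists q, nbhs 0 np.2.2 -> next np.1 np.2 q.
  case: np => n [x W]; have [W0|nW0] := pselect (nbhs 0 W); last by exists (x, W).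
  have Wx : nbhs x (interior [set z | W (z - x)]).
    apply/nbhs_interior/nbhs_translate; apply: filterS W0 => v /=.
    by rewrite addrC addKr.
  have [x' Gx' Wx'] := dense_nbhs (Gdense n) Wx.
  have : nbhs x' (G n `&` [set z | W (z - x)]).
    by apply: filterI => //; exact: open_nbhs_nbhs.
  move=> /nbhs_translate/(filterI (B0 n))/nbhs0_circled[W' W'0 [W'c W'U W'add]].
  exists (x', W') => _; split => //; split => //.
    by move=> u /W'U[].
  by move=> u v W'u W'v; have [_ []] := W'add _ _ W'u W'v.
have [f fP] := choice step.
pose s := fix s n := if n is n'.+1 then f (n', s n') else (0 : X, [set: X]).
have s0 n : nbhs 0 (s n).2.
  elim: n => [|n IH]; first exact: filterT.
  by have [] := fP (n, s n) IH.
have sP n : next n (s n) (s n.+1) by exact: (fP (n, s n) (s0 n)).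
have nested n m u : (n <= m)%N -> (s m).2 u -> (s n).2 ((s m).1 + u - (s n).1).
  move=> /subnKC <-; elim: (m - n)%N u => [|j IH] u.
    by rewrite addn0 addrC addKr.
  rewrite addnS => su; have [_ [_ _ /(_ u 0 su)]] := sP (n + j)%N.
  move=> /(_ (nbhs_singleton (s0 _)))[_]; rewrite addr0 => /IH.
  by rewrite subrKC.
have near_s n m : (n <= m)%N -> (s n).2 ((s m).1 - (s n).1).
  by move=> /nested/(_ (nbhs_singleton (s0 m))); rewrite addr0.
have [|l sl] := Xcomplete (fun n => (s n).1).
  move=> U /nbhs0_circled[W W0 [Wc WU Wadd]].
  have [n BW] := Bbase _ W0; exists n.+1 => m m' nm nm'.
  have [_ [sc sB _]] := sP n.
  rewrite -(subrKA (s n.+1).1); apply: Wadd; apply/BW/sB; first exact: near_s.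
  rewrite -opprB -scaleN1r; apply: sc; first by rewrite normrN1.
  exact: near_s.
exists l => n; have [sn0 [sc _ sG]] := sP n.
have /sl[M _ HM] : nbhs l [set z | (s n.+1).2 (l - z)].
  apply/nbhs_translate; apply: filterS sn0 => v sv /=.
  by rewrite opprD addNKr -scaleN1r; apply: sc; rewrite ?normrN1.
have := HM (maxn M n.+1) (leq_maxl _ _) => /= sl1.
have := near_s _ _ (leq_maxr M n.+1) => sl2.
have [+ _] := sG _ _ sl2 sl1.
by rewrite [X in _ + X]addrC subrKA subrKC.
Qed.

End Frechet.

(** * Orbits returning to a neighbourhood along a prescribed set *)

Section Approach.
Variables (R : realType) (X : tvsType R[i]) (T : {linear X -> X}).
Implicit Types (U V W : set X) (x y z v : X) (A : set nat).

(** Pigeonhole on the circle: [A] is thinned first by the real part of [lam ^+ k], then by the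
    imaginary part, with oscillation [e / 2] each. *)
Lemma unimodular_power_oscillation (lam : R[i]) A (e : R) :
  `|lam| = 1 -> posdens R A -> 0 < e ->
  exists2 B, B `<=` A & posdens R B /\
    forall k l, B k -> B l -> `|lam ^+ k - lam ^+ l| <= e%:C%C.
Proof.
move=> lam1 pA e0.
have e2 : 0 < e / 2 by lra.
(* Enough strips of width [e / 2] to cover [[-1, 1]]. *)
have [n Hn] : exists n : nat, 2 <= n%:R * (e / 2).
  exists (Num.bound (2 / (e / 2))); rewrite -ler_pdivrMr//.
  by rewrite ltW// archi_boundP// divr_ge0// ltW.
have bnd (a b : R) k : lam ^+ k = (a +i* b)%C -> (`|a| <= 1) && (`|b| <= 1).
  move=> E; have : `|lam ^+ k| = 1 by rewrite normrX lam1 expr1n.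
  rewrite E normc_def/= => /(congr1 (@complex.Re R))/= ab.
  rewrite -!(ler_sqr (_ : `|_| \is Num.nneg) (_ : 1 \is Num.nneg)) ?nnegrE//.
  rewrite !real_normK ?num_real// expr1n.
  have : Num.sqrt (a ^+ 2 + b ^+ 2) ^+ 2 = 1 by rewrite ab expr1n.
  rewrite sqr_sqrtr ?addr_ge0 ?sqr_ge0// => <-.
  by rewrite lerDl lerDr !sqr_ge0.
have strip (a : R) : `|a| <= 1 -> -1 <= a <= -1 + n%:R * (e / 2).
  by rewrite ler_norml => /andP[-> a1]/=; lra.
have [|B BA [pB HB]] := @posdens_small_oscillation R A
    (fun k => complex.Re (lam ^+ k)) (-1) (e / 2) n pA _ e2.
  by move=> k _; apply: strip; case E: (lam ^+ k) => [a b] /=; case/andP: (bnd _ _ _ E).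
have [|C CB [pC HC]] := @posdens_small_oscillation R B
    (fun k => complex.Im (lam ^+ k)) (-1) (e / 2) n pB _ e2.
  by move=> k _; apply: strip; case E: (lam ^+ k) => [a b] /=; case/andP: (bnd _ _ _ E).
exists C; first exact: subset_trans BA.
split=> // k l Ck Cl.
have := HB _ _ (CB _ Ck) (CB _ Cl); have := HC _ _ Ck Cl.
case: (lam ^+ k) => a b; case: (lam ^+ l) => a' b' /= bb aa.
rewrite normc_def lecR/= -[e]ger0_norm ?(ltW e0)// -sqrtr_sqr ler_wsqrtr//.
rewrite -[X in X + _]real_normK ?num_real// -[X in _ + X]real_normK ?num_real//.
have := normr_ge0 (a - a'); have := normr_ge0 (b - b'); nra.
Qed.

Definition approachable v := forall U A, nbhs (0 : X) U -> posdens R A ->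
  exists y B, [/\ B `<=` A, posdens R B & forall k, B k -> U (iter k T y - v)].

Lemma approachable0 : approachable 0.
Proof.
move=> U A U0 pA; exists 0, A; split=> // k _.
have -> : iter k T 0 = 0 by elim: k => //= k ->; rewrite linear0.
by rewrite subr0; exact: nbhs_singleton.
Qed.

Lemma approachableZ (c : R[i]) v : approachable v -> approachable (c *: v).
Proof.
move=> av U A U0 pA; have [y [B [BA pB HB]]] := av _ A (nbhs0_scale c U0) pA.
by exists (c *: y), B; split=> // k /HB; rewrite iter_linearZ -scalerBr.
Qed.

(** The set [B1] obtained for [v1] becomes the prescribed set for [v2]; this is why [approachable]
    quantifies over every [A]. *)
Lemma approachableD v1 v2 : approachable v1 -> approachable v2 -> approachable (v1 + v2).
Proof.
move=> a1 a2 U A U0 pA; have [W W0 [_ _ Wadd]] := nbhs0_circled U0.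
have [y1 [B1 [B1A pB1 HB1]]] := a1 W A W0 pA.
have [y2 [B2 [B2B1 pB2 HB2]]] := a2 W B1 W0 pB1.
exists (y1 + y2), B2; split=> [| //|k B2k]; first exact: subset_trans B1A.
by rewrite iter_linearD opprD addrACA; apply: Wadd; [apply/HB1/B2B1|exact: HB2].
Qed.

(** Fix [l] in a set [B] on which the powers of [lam] nearly agree, and rotate [v] by the inverse of
    [lam ^+ l]: at each time [k] in [B] the orbit is back near [v]. *)
Lemma approachable_eigenvector (lam : R[i]) v :
  `|lam| = 1 -> T v = lam *: v -> approachable v.
Proof.
move=> lam1 Tv U A U0 pA; have [ep ep0 Uv] := nbhs0_scalar v U0.
have epE := RRe_real (gtr0_real ep0).
have r0 : 0 < complex.Re ep by rewrite -ltcR epE.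
have r2 : 0 < complex.Re ep / 2 by lra.
have [B BA [pB HB]] := unimodular_power_oscillation lam1 pA r2.
have [l Bl] := posdens_nonempty pB.
have lam0 : lam ^+ l != 0 by rewrite -normr_gt0 normrX lam1 expr1n.
exists ((lam ^+ l)^-1 *: v), B; split=> // k Bk.
have -> : iter k T ((lam ^+ l)^-1 *: v) - v = ((lam ^+ l)^-1 * (lam ^+ k - lam ^+ l)) *: v.
  have -> : iter k T ((lam ^+ l)^-1 *: v) = (lam ^+ k / lam ^+ l) *: v.
    rewrite iter_linearZ mulrC -scalerA; congr (_ *: _).
    elim: k {Bk} => [|k IH]; first by rewrite scale1r.
    by rewrite iterS IH linearZ/= Tv scalerA exprSr.
  by rewrite mulrBr mulVf// scalerBl scale1r mulrC.
apply: Uv; rewrite normrM normfV normrX lam1 expr1n invr1 mul1r.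
by apply: (le_lt_trans (HB _ _ Bk Bl)); rewrite -epE ltcR; lra.
Qed.

Lemma approachable_lin_span (S : set X) : (forall e, S e -> approachable e) ->
  forall v, lin_span S v -> approachable v.
Proof.
move=> Sa _ [n [c [v [Sv ->]]]].
elim/big_ind: _ => [|x y|i _]; first exact: approachable0.
  exact: approachableD.
by apply: approachableZ; apply: Sa.
Qed.

Definition often_returning V A (d : R) n := [set x |
  exists2 N, (n <= N)%N & d * N%:R <= count_upto R (return_set T x V `&` A) N].

Lemma dense_often_returning V A :
  dense [set v | approachable v] -> dense [set z | spreadable T z] ->
  open V -> V !=set0 -> posdens R A ->
  exists2 d, 0 < d & forall n, dense (often_returning V A d n).
Proof.
move=> da ds Vo [v0 Vv0] pA.
have [v av Vv] := dense_nbhs da (open_nbhs_nbhs (conj Vo Vv0)).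
have /nbhs_translate/nbhs0_circled[U U0 [_ _ Uadd]] := open_nbhs_nbhs (conj Vo Vv).
have [y [B [BA [d d0 pB] HB]]] := av U A U0 pA.
have d2 : 0 < d / 2 by lra.
(* [d] comes from [y] alone, before [n] and [O] are given; the bad times of [z'] will cost at most
   half of it. *)
exists (d / 2) => // n O [w Ow] Oo.
have /nbhs_translate Ow0 := open_nbhs_nbhs (conj Oo Ow).
have [|z sz Oz] := @dense_nbhs _ _ (w - y) [set z | O (y + z)] ds.
  apply/nbhs_translate; apply: filterS Ow0 => u /=.
  by rewrite addrA subrKC.
have Oz0 : nbhs 0 [set u | O (y + z + u)].
  exact: (iffLR (nbhs_translate (y + z) O) (open_nbhs_nbhs (conj Oo Oz))).
have [z' [Uz' Oz'] [N0 HN0]] := sz _ _ (filterI U0 Oz0) d2.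
exists (y + z'); split.
  by move: Oz' => /=; rewrite -addrA subrKC.
have [N nN dN] := pB (maxn n N0).
move: nN; rewrite geq_max => /andP[nN /HN0 {}HN0]; exists N => //.
have /(@count_uptoU R _ _ _ N) : B `<=` (return_set T (y + z') V `&` A) `|`
    [set k | ~ (U `&` [set u | O (y + z + u)]) (iter k T z')].
  move=> k Bk; have [[Uk _]|] := pselect ((U `&` [set u | O (y + z + u)]) (iter k T z')); last by right.
  left; split; last exact: BA.
  have /= := Uadd _ _ (HB _ Bk) Uk.
  by rewrite /return_set/= iter_linearD addrA subrKC.
by move: HN0 dN; lra.
Qed.

(** The witness [N] is kept: the returns up to time [N] are finitely many open conditions on [x]. *)
Lemma open_often_returning V A d n :
  continuous T -> open V -> open (often_returning V A d n).
Proof.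
move=> Tc Vo; have Tkc k : continuous (iter k T).
  by elim: k => [|k IH] x; [exact: cvg_id|apply: continuous_comp; [exact: IH|exact: Tc]].
rewrite openE => x [N nN dN]; rewrite /interior /=.
have : nbhs x [set x' | forall k, (k < N.+1)%N -> return_set T x V k -> return_set T x' V k].
  elim: N.+1 => [|m IH]; first by apply: filterS filterT => x' _ k.
  have /filterI/(_ IH) : nbhs x [set x' | return_set T x V m -> return_set T x' V m].
    have [xV|nxV] := pselect (return_set T x V m); last by apply: filterS filterT => x' _ /nxV.
    have : nbhs x (iter m T @^-1` V) by apply: Tkc; exact: open_nbhs_nbhs.
    by apply: filterS => x' Vx' _.
  apply: filterS => x' [Hm Hk] k; rewrite ltnS leq_eqVlt => /predU1P[->//|].
  exact: Hk.
apply: filterS => x' Hx'; exists N => //; apply: (le_trans dN).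
rewrite /count_upto !big_nat; apply: ler_sum => k /andP[_ kN].
rewrite ler_nat; case: (boolP (k \in _)) => // /set_mem[/(Hx' _ kN) Vk Ak].
by rewrite mem_set.
Qed.

Lemma dense_spreadable : frechet_space X -> separable X ->
  perfectly_spanning T -> dense [set z | spreadable T z].
Proof.
move=> fX sX pT; have [Bs Bsc BsP] := countable_base fX sX.
pose N := \bigcup_(V in Bs `&` [set V | countable (eigenvalues_in T V)]) eigenvalues_in T V.
have Ncirc : N `<=` unit_circle R by move=> lam [V _ []].
have Nc : countable N.
  apply: bigcup_countable => [|V []//].
  by apply: sub_countable Bsc; apply: subset_card_le; exact: subIsetl.
move=> O On Oo; have [z [Oz Sz]] := pT N Ncirc Nc O On Oo.
exists z; split=> //; apply: spreadable_lin_span Sz => e [e0 [lam [lam1 Nlam] Te]].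
(* If [U] had only finitely many eigenvalues, so would a basic [V] inside [U] around [e], and [lam]
   would belong to [N]. *)
apply: spreadable_eigenvector => U /BsP[V [BsV Ve VU]] Ufin; apply: Nlam.
exists V; last by split=> //; exists e; split=> //; exact: nbhs_singleton.
split=> //=; apply: finite_set_countable; apply: sub_finite_set Ufin.
by move=> mu [mu1 [v [/VU Uv v0 Tv]]]; split=> //; exists v.
Qed.

Lemma dense_approachable : perfectly_spanning T -> dense [set v | approachable v].
Proof.
move=> pT O On Oo.
have [z [Oz Sz]] := pT set0 (@sub0set _ _) (@countable0 _) O On Oo.
exists z; split=> //; apply: approachable_lin_span Sz => e [_ [lam [lam1 _] Te]].
exact: approachable_eigenvector Te.
Qed.

End Approach.

Theorem theorem3p20 (R : realType) (X : tvsType R[i]) (T : {linear X -> X}) :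
  frechet_space X -> separable X -> continuous T ->
  perfectly_spanning T -> hereditarily_Ufhc T.
Proof.
move=> fX sX Tc pT I V A /countable_injP[g ginj] VP AP.
have /choice[d dP] i : exists d : R, 0 < d /\
    forall n, dense (often_returning T (V i) (A i) d n).
  have [Vo Vn] := VP i; have /upper_density_gt0P pA := AP i.
  have [d d0 dd] := dense_often_returning (dense_approachable pT)
    (dense_spreadable fX sX pT) Vo Vn pA.
  by exists d.
(* The pairs [(i, m)] are coded by naturals through the injection [g]; a [k] that codes no pair
   gives the whole space. As [d i] does not depend on [m], a point in every [G k] has positive upper
   density of returns for each [i]. *)
pose G (k : nat) := [set x | forall i m, unpickle k = Some (g i, m) ->
  often_returning T (V i) (A i) (d i) m x].
have GE k : G k = setT \/ exists i m, G k = often_returning T (V i) (A i) (d i) m.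
  have [[i [m km]]|nk] := pselect (exists i (m : nat), unpickle k = Some (g i, m)).
    right; exists i, m; apply/seteqP; split=> x; first exact.
    by move=> xO j m'; rewrite km => -[/ginj]; rewrite !inE => <- // <-.
  left; apply/seteqP; split=> // x _ i m km; case: nk; by exists i, m.
have [||x xG] := @frechet_baire R X G fX.
- move=> k; have [->|[i [m ->]]] := GE k; first exact: openT.
  by apply: open_often_returning => //; case: (VP i).
- move=> k; have [->|[i [m ->]]] := GE k; last by case: (dP i) => _; apply.
  by move=> O On _; rewrite setIT.
exists x => i; apply/upper_density_gt0P; exists (d i); first by case: (dP i).
by move=> n; exact: (xG _ i n (pickleK _)).
Qed.
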